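(* For every DAG $G$ and every positive integer $r$, $$\mathrm{OPT}_{PRBP}(G,r)\ \ge\ r\cdot\left(\mathrm{MIN}_{edge}(2r)-1\right).$$
   Context: All DAGs $G=(V,E)$ are finite and have no isolated nodes. Sources are nodes of in-degree 0, sinks are nodes of out-degree 0. The integer $r$ is the fast memory capacity. Partial-computing red-blue pebble game (PRBP, one-shot). There are blue, light red and dark red pebbles, and edges can be marked. Initially exactly the sources carry blue pebbles, there are no other pebbles, and all edges are unmarked. Moves: (1) Save: replace a dark red pebble on a node by a blue and a light red pebble. (2) Load: place a light red pebble on a node that has a blue pebble. (3) Partial compute: for an unmarked edge $(u,v)$ such that (i) all incoming edges of $u$ are marked, (ii) $u$ has a (light or dark) red pebble, and (iii) $v$ has a (light or dark) red pebble or no pebble at all, replace all pebbles on $v$ by one dark red pebble and mark $(u,v)$ (each edge is marked at most once and never unmarked). (4) Delete: remove a light red pebble from any node, or remove a dark red pebble from a non-sink node all of whose outgoing edges are marked. At every time the total number of (light and dark) red pebbles is at most $r$. A pebbling is a sequence of moves after which every sink has a blue pebble and every edge is marked. Its cost is the total number of save and load moves, and $\mathrm{OPT}_{PRBP}(G,r)$ is the minimum cost of a pebbling of $G$ with capacity $r$ ($+\infty$ if none exists; one exists whenever $r\ge 2$). $S$-edge partitions. For $E_0\subseteq E$, a set $D\subseteq V$ is an edge-dominator for $E_0$ if every directed path that starts at a source and contains an edge of $E_0$ contains a node of $D$. The edge-terminal set of $E_0$ is the set of nodes $v\in V$ such that at least one incoming edge of $v$ is in $E_0$ but no outgoing edge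 of $v$ is in $E_0$. An $S$-edge partition of $G$ is a partition of $E$ into disjoint classes $E_1,\dots,E_k$ such that: (i) for $(u,v),(v,w)\in E$ and $i<j$ we never have $(v,w)\in E_i$ and $(u,v)\in E_j$; (ii) each $E_i$ has an edge-dominator of size at most $S$; (iii) the edge-terminal set of each $E_i$ has size at most $S$. $\mathrm{MIN}_{edge}(S)$ is the minimum number of classes of any $S$-edge partition of $G$. *)

(* Defs.v *)
From HB Require Import structures.
From mathcomp Require Import all_boot all_order all_algebra.
From mathcomp Require Import boolp constructive_ereal.

Set Implicit Arguments.
Unset Strict Implicit.
Unset Printing Implicit Defensive.

(* The least n with P n as an extended integer, +oo if there is none. *)
Definition emin (P : nat -> Prop) : \bar int :=
  if pselect (exists n, `[< P n >]) is left exP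
  then ((ex_minn exP)%:Z)%:E%E else +oo%E.

Section Graph.
Variables (V : finType) (e : rel V).
Implicit Types (u v w : V) (F : {set V * V}) (D : {set V}).

Definition acyclic := forall c : seq V, c != [::] -> ~~ cycle e c.
Definition no_isolated := forall v, exists w, e v w || e w v.
Definition dag := acyclic /\ no_isolated.

Definition source v := [forall u, ~~ e u v].
Definition sink v := [forall w, ~~ e v w].
Definition edges : {set V * V} := [set a | e a.1 a.2].
Definition in_edges v := [set a in edges | a.2 == v].
Definition out_edges v := [set a in edges | a.1 == v].

(* The consecutive pairs of v :: p. *)
Definition path_edges v (p : seq V) : seq (V * V) := zip (v :: p) p.

Definition edge_dominator F D :=
  forall s p, source s -> path e s p -> has (mem F) (path_edges s p) ->
  has (mem D) (s :: p).

Definition edge_terminal F : {set V} :=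
  [set v | [exists u, (u, v) \in F] && [forall w, (v, w) \notin F]].

Definition edge_partition (S k : nat) (P : k.-tuple {set V * V}) :=
  [/\ uniq P /\ partition [set:: P] edges,
      forall (i j : 'I_k) u v w, i < j ->
        ~ ((v, w) \in tnth P i /\ (u, v) \in tnth P j),
      forall i, exists D, edge_dominator (tnth P i) D /\ #|D| <= S
    & forall i, #|edge_terminal (tnth P i)| <= S].

Definition MIN_edge (S : nat) : \bar int :=
  emin (fun k => exists P : k.-tuple {set V * V}, edge_partition S P).

(* Pebbles are tracked per colour: a node carries at most one of each. *)
Record config := Config {
  blue : {set V};
  light : {set V};
  dark : {set V};
  marked : {set V * V}
}.

Definition init := Config [set v | source v] set0 set0 set0.

Definition red c := light c :|: dark c.

Inductive move :=
  | MSave of V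
  | MLoad of V
  | MCompute of V & V
  | MDeleteLight of V
  | MDeleteDark of V.

Definition legal c m :=
  match m with
  | MSave v => v \in dark c
  | MLoad v => v \in blue c
  | MCompute u v =>
      [&& (u, v) \in edges :\: marked c, in_edges u \subset marked c,
          u \in red c & (v \in red c) || (v \notin blue c)]
  | MDeleteLight v => v \in light c
  | MDeleteDark v =>
      [&& v \in dark c, ~~ sink v & out_edges v \subset marked c]
  end.

Definition step c m :=
  match m with
  | MSave v => Config (v |: blue c) (v |: light c) (dark c :\ v) (marked c)
  | MLoad v => Config (blue c) (v |: light c) (dark c) (marked c)
  | MCompute u v =>
      Config (blue c :\ v) (light c :\ v) (v |: dark c) ((u, v) |: marked c)
  | MDeleteLight v => Config (blue c) (light c :\ v) (dark c) (marked c)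
  | MDeleteDark v => Config (blue c) (light c) (dark c :\ v) (marked c)
  end.

Definition within (r : nat) c := #|light c| + #|dark c| <= r.

Fixpoint legal_run (r : nat) c (ms : seq move) :=
  within r c &&
  (if ms is m :: ms' then legal c m && legal_run r (step c m) ms' else true).

Definition final c := [set v | sink v] \subset blue c /\ marked c = edges.

Definition pebbling (r : nat) (ms : seq move) :=
  legal_run r init ms /\ final (foldl step init ms).

Definition is_io m :=
  match m with MSave _ | MLoad _ => true | _ => false end.

Definition cost (ms : seq move) := count is_io ms.

Definition OPT_PRBP (r : nat) : \bar int :=
  emin (fun n => exists2 ms, pebbling r ms & cost ms = n).

End Graph.

(* Main.v *)
(** Cut an optimal pebbling into phases of at most [r] I/O moves, all but the
    first containing exactly [r] of them, and let the classes be the sets of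
    edges marked during the phases.  The nodes that are red at the start of a
    phase or loaded during it dominate its class: any other node [u] whose
    out-edge is marked in the phase had no pebble when it was first computed in
    the phase, so all in-edges of [u] are marked in the phase too, and one can
    walk back along the path.  A terminal node of a class was dark at some
    point of the phase and could not be deleted, so it was saved during the
    phase or is still dark at its end. *)

Require Import Defs.
From mathcomp Require Import all_boot all_order all_algebra.
From mathcomp Require Import boolp constructive_ereal.
From mathcomp Require Import zify.

Set Implicit Arguments.
Unset Strict Implicit.
Unset Printing Implicit Defensive.

(** * Minima in the extended integers *)

Lemma eminP (P : nat -> Prop) :
  (exists2 n, P n & emin P = n%:Z%:E%E) \/ emin P = +oo%E.
Proof.
rewrite /emin; case: pselect => [exP|_]; [left | by right].
by case: ex_minnP => n /asboolP Pn _; exists n.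
Qed.

Lemma emin_le (P : nat -> Prop) n :
  P n -> exists2 k, emin P = k%:Z%:E%E & k <= n.
Proof.
move=> Pn; rewrite /emin; case: pselect => [exP|[]]; last by exists n; apply/asboolP.
by case: ex_minnP => k _ min_k; exists k => //; apply/min_k/asboolP.
Qed.

Section Pebbling.
Variables (V : finType) (e : rel V).
Implicit Types (u v w : V) (c : config V) (m : move V) (s : seq (move V)).

(** * Runs of the game and what they preserve *)

Definition io_node m :=
  match m with MSave v | MLoad v => Some v | _ => None end.

Definition io_nodes s : {set V} := [set:: pmap io_node s].

Lemma card_io_nodes s : #|io_nodes s| <= cost s.
Proof.
rewrite cardsE (leq_trans (card_size _)) // size_pmap /cost.
by apply/eq_leq/eq_count; case.
Qed.

Lemma legal_run_cat r c s1 s2 : legal_run e r c (s1 ++ s2) ->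
  legal_run e r c s1 /\ legal_run e r (foldl (@step V) c s1) s2.
Proof.
elim: s1 c => [|m s1 IH] c /=.
  by move=> run_c; split=> //; case: s2 run_c => [|? ?] /= /andP[-> _].
by case/and3P=> -> -> /IH.
Qed.

Lemma legal_run_within r c s : legal_run e r c s ->
  within r c /\ within r (foldl (@step V) c s).
Proof.
elim: s c => [|m s IH] c /=; first by case/andP.
by case/and3P=> -> _ /IH[].
Qed.

(** [X] stays fixed while [s] shrinks in the induction, so that [P] may refer to the I/O nodes of a
    whole phase. *)
Lemma legal_run_ind (X : {set V}) (P : config V -> Prop) r c s :
  (forall c m, legal e c m -> (forall v, io_node m = Some v -> v \in X) ->
     P c -> P (step c m)) ->
  io_nodes s \subset X -> legal_run e r c s -> P c ->
  P (foldl (@step V) c s).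
Proof.
move=> stepP; elim: s c => [|m s IH] c //= /subsetP sX /and3P[_ leg run] Pc.
apply: IH => //; last first.
  apply: stepP => // v mv; apply: sX.
  by rewrite inE /= mv inE eqxx.
apply/subsetP => v; rewrite inE => sv; apply: sX; rewrite inE /=.
by case: (io_node m) => //= w; rewrite inE sv orbT.
Qed.

(* The last clause holds because a dark pebble is only deleted once all
   out-edges are marked, and a blue one is only replaced by a dark one. *)
Definition reachable_inv c :=
  [/\ marked c \subset edges e,
      forall u v, (u, v) \in marked c -> in_edges e u \subset marked c
    & forall u v w, (u, v) \in marked c -> e v w -> (v, w) \notin marked c ->
        (v \in blue c) || (v \in dark c)].

Lemma reachable_inv_init : reachable_inv (init e).
Proof. by split=> [|u v|u v w]; rewrite ?sub0set ?inE. Qed.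

Lemma reachable_inv_step c m :
  legal e c m -> reachable_inv c -> reachable_inv (step c m).
Proof.
case: m => [v|v|x y|v|v] /= leg [mE mI mB]; split => //=.
- move=> a b w ab bw /(mB _ _ _ ab bw); rewrite !inE.
  by case: (b == v) => //=.
- rewrite subUset mE andbT sub1set.
  by case/and4P: leg => /setDP[].
- move=> a b; case/and4P: leg => _ inx _ _; rewrite in_setU1 => /orP[|/mI].
    by case/eqP=> -> _; apply: subset_trans inx (subsetUr _ _).
  by move/subset_trans; apply; apply: subsetUr.
- move=> a b w; rewrite !inE; case: (eqVneq b y) => [//|nby] /=.
  rewrite xpair_eqE (negPf nby) andbF /= => ab bw /norP[_]; exact: mB ab bw.
- move=> a b w ab bw nbw; case/and3P: leg => _ _ /subsetP out.
  have := mB _ _ _ ab bw nbw; rewrite !inE; case: (eqVneq b v) => // bv.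
  by case/negP: nbw; apply: out; rewrite !inE /= bw bv eqxx.
Qed.

Lemma reachable_inv_run r c s : legal_run e r c s ->
  reachable_inv c -> reachable_inv (foldl (@step V) c s).
Proof.
apply: (@legal_run_ind setT) => [? ? leg _|]; last exact: subsetT.
exact: reachable_inv_step.
Qed.

Lemma marked_step c m : marked c \subset marked (step c m).
Proof. by case: m => //= *; apply: subsetUr. Qed.

Lemma marked_run c s : marked c \subset marked (foldl (@step V) c s).
Proof.
elim: s c => //= m s IH c; exact: subset_trans (marked_step c m) (IH _).
Qed.

(** * Edges marked during one phase *)

Definition phase_class c s := marked (foldl (@step V) c s) :\: marked c.

(** A node outside [X] turns red only by a partial compute, at a moment when it has no pebble
    although an out-edge is unmarked; [reachable_inv] then excludes marked in-edges. Yet all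
    in-edges are marked once an out-edge is. *)
Lemma phase_class_back r c s : legal_run e r c s -> reachable_inv c ->
  forall u v, u \notin red c :|: io_nodes s -> (u, v) \in phase_class c s ->
  ~~ source e u /\ in_edges e u \subset phase_class c s.
Proof.
move=> run inv0; set X := red c :|: io_nodes s.
(* [nice] speaks only of the start [c], so it persists once established: the third clause of [P]
   provides it while [u] is red, the fourth keeps it after an out-edge of [u] is marked. *)
pose nice u := ~~ source e u /\ [disjoint in_edges e u & marked c].
pose P c1 := [/\ reachable_inv c1, marked c \subset marked c1,
  forall u w, u \notin X -> u \in red c1 -> e u w -> (u, w) \notin marked c1 ->
    nice u
  & forall u v, u \notin X -> (u, v) \in marked c1 :\: marked c -> nice u].
have : P (foldl (@step V) c s).
  apply: (@legal_run_ind X P r c s _ (subsetUr _ _) run); last first.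
    split=> // [u w|u v]; last by rewrite setDv in_set0.
    by rewrite inE negb_or => /andP[/negPf->].
  move=> c1 m leg mX [inv sub nred nout]; split.
  - exact: reachable_inv_step.
  - exact: subset_trans sub (marked_step _ _).
  - case: m leg mX => [v|v|x y|v|v] /= leg mX u w uX; rewrite /red !inE => ured uw nuw.
    + apply: (nred u w) => //; rewrite !inE.
      by case: (eqVneq u v) ured => [->|_] //=; rewrite leg orbT.
    + apply: (nred u w) => //; rewrite !inE.
      by case: (eqVneq u v) ured uX => [->|_] //=; rewrite mX.
    + case/norP: nuw => _ nuw.
      (* If [u] was not red before the move, it is the head [y] just computed, and legality says
         that it was not blue either. *)
      case: (boolP (u \in red c1)) => [ru|nru]; first exact: nred ru uw nuw.
      have uy : u = y.
        move: nru ured; rewrite !inE => /norP[/negPf-> /negPf->].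
          by rewrite andbF orbF => /eqP.
      subst y; case/and4P: leg => /setDP[]; rewrite inE /= => xu _ _ _.
      rewrite (negPf nru) /= => nbu; split.
        by apply/negP => /forallP/(_ x); rewrite xu.
      (* An in-edge of [u] marked before the phase is still marked; as [(u, w)] is not, [u] would
         carry a blue or dark pebble. *)
      rewrite disjoint_subset; apply/subsetP => -[a b].
      rewrite !inE /= => /andP[_ /eqP->]; apply/negP => /(subsetP sub) au.
      have [_ _ /(_ _ _ _ au uw nuw)] := inv.
      by rewrite (negPf nbu) /= => du; move: nru; rewrite inE du orbT.
    + apply: (nred u w) => //; rewrite !inE.
      by case/orP: ured => [/andP[_ ->]|->]; rewrite ?orbT.
    + apply: (nred u w) => //; rewrite !inE.
      by case/orP: ured => [->|/andP[_ ->]]; rewrite ?orbT.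
  - case: m leg {mX} => [v|v|x y|v|v] //= leg u w uX; try exact: nout.
    rewrite in_setD in_setU1 => /andP[ncuw /orP[/eqP[ux _]|uw]]; last first.
      by apply: (nout u w uX); rewrite in_setD ncuw uw.
    subst x; case/and4P: leg => /setDP[]; rewrite inE /= => uy nuy _ ru _.
    exact: nred ru uy nuy.
case=> -[_ mI _] _ _ nout u v uX uv; have [nsrc disj] := nout u v uX uv.
split=> //; apply/subsetP => a au; rewrite in_setD (disjointFr disj au) /=.
by apply: subsetP au; apply: mI; case/setDP: uv => uv _; apply: uv.
Qed.

Lemma path_edges_rcons (x y : V) p :
  path_edges x (rcons p y) = rcons (path_edges x p) (last x p, y).
Proof. by elim: p x => //= z p IH x; congr cons; apply: IH. Qed.

(** Induction on the path from its far end: if the tail of the last edge escapes the dominator, the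
    preceding edge is in the class too. The descent stops at the source [x] at the latest, since
    [phase_class_back] excludes sources as such tails. *)
Lemma phase_class_dominator r c s : legal_run e r c s -> reachable_inv c ->
  edge_dominator e (phase_class c s) (red c :|: io_nodes s).
Proof.
move=> run inv x p srcx; elim/last_ind: p => [//|p y IH].
rewrite rcons_path path_edges_rcons -rcons_cons !has_rcons => /andP[xp _].
case/orP=> [xy|/(IH xp)->]; last by rewrite orbT.
apply/orP; right; case: (boolP (last x p \in red c :|: io_nodes s)) => lX.
  by apply/hasP; exists (last x p) => //; apply: mem_last.
have [nsrc /subsetP back] := phase_class_back run inv lX xy.
case/lastP: p => [|p u] in xp xy IH lX nsrc back *; first by rewrite srcx in nsrc.
move: xp; rewrite rcons_path last_rcons in back * => /andP[xp pu].
apply: IH; first by rewrite rcons_path xp.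
rewrite path_edges_rcons has_rcons /= back //.
by rewrite !inE /= pu eqxx.
Qed.

Lemma phase_class_terminal r c s : legal_run e r c s -> reachable_inv c ->
  edge_terminal (phase_class c s) \subset
    dark (foldl (@step V) c s) :|: io_nodes s.
Proof.
move=> run inv0.
(* The third alternative contradicts being terminal; it absorbs the dark pebbles deleted during the
   phase. *)
pose P c1 := reachable_inv c1 /\ forall u v, (u, v) \in marked c1 :\: marked c ->
  [|| v \in dark c1, v \in io_nodes s
    | [exists w, (v, w) \in marked c1 :\: marked c]].
have : P (foldl (@step V) c s).
  apply: (@legal_run_ind (io_nodes s) P r c s _ (subxx _) run); last first.
    by split=> // u v; rewrite setDv inE.
  move=> c1 m leg mX [inv dk]; split; first exact: reachable_inv_step.
  case: m leg mX => [x|x|x y|x|x] //= leg mX u v uv.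
  - move: (dk u v uv); rewrite in_setD1; case: eqVneq => // ->.
    by rewrite (mX x) // orbT.
  - rewrite in_setU1; case: (eqVneq v y) => //= nvy; move: uv.
    rewrite in_setD in_setU1 xpair_eqE (negPf nvy) andbF /= -in_setD => /dk.
    case/or3P=> [->|->|/existsP[w vw]]; rewrite ?orbT //.
    apply/orP; right; apply/orP; right; apply/existsP; exists w.
    by move: vw; rewrite !in_setD in_setU1 => /andP[-> ->]; rewrite orbT.
  (* The non-sink [x] has an out-edge [(x, w)], already marked. Had it been marked before the phase,
     so would have been [(u, x)], which was marked only during it. *)
  - move: (dk u v uv); rewrite in_setD1; case: eqVneq => //= vx _.
    subst v; case/and3P: leg => _ /forallPn[w /negPn xw] /subsetP out.
    have xwm : (x, w) \in marked c1 by apply: out; rewrite !inE /= xw eqxx.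
    apply/orP; right; apply/existsP; exists w; rewrite in_setD xwm andbT.
    apply/negP => xw0; case/setDP: uv => um /negP; apply.
    have [_ /(_ _ _ xw0)/subsetP mI _] := inv0; apply: mI.
    by have [/subsetP/(_ _ um) + _ _] := inv; rewrite !inE /= => ->; rewrite eqxx.
case=> _ dk; apply/subsetP => v; rewrite inE => /andP[/existsP[u uv] /forallP nout].
by case/or3P: (dk u v uv) => [|| /existsP[w vw]]; rewrite ?inE;
  [move->|move->; rewrite orbT|have := nout w; rewrite vw].
Qed.

Lemma phase_class_bounds r c s : reachable_inv c -> legal_run e r c s ->
  cost s <= r ->
  (exists D, edge_dominator e (phase_class c s) D /\ #|D| <= 2 * r) /\
  #|edge_terminal (phase_class c s)| <= 2 * r.
Proof.
move=> inv run sr; have [win0 win1] := legal_run_within run.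
have ior : #|io_nodes s| <= r := leq_trans (card_io_nodes s) sr.
(* One [r] bounds the pebbles at the start or end of the phase, the other the I/O moves. *)
rewrite mul2n -addnn; split.
  exists (red c :|: io_nodes s); split; first exact: phase_class_dominator run inv.
  apply: leq_trans (leq_card_setU _ _) (leq_add (leq_trans _ win0) ior).
  exact: leq_card_setU.
apply: leq_trans (subset_leq_card (phase_class_terminal run inv)) _.
apply: leq_trans (leq_card_setU _ _) (leq_add (leq_trans _ win1) ior).
exact: leq_addl.
Qed.

(** * Classes of consecutive phases *)

Fixpoint classes c (ss : seq (seq (move V))) : seq {set V * V} :=
  if ss is s :: ss' then phase_class c s :: classes (foldl (@step V) c s) ss'
  else [::].

Lemma size_classes c ss : size (classes c ss) = size ss.
Proof. by elim: ss c => //= s ss IH c; rewrite IH. Qed.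

Lemma classes_bounds r c ss : reachable_inv c -> legal_run e r c (flatten ss) ->
  all (fun s => cost s <= r) ss ->
  forall F, F \in classes c ss ->
  (exists D, edge_dominator e F D /\ #|D| <= 2 * r) /\
  #|edge_terminal F| <= 2 * r.
Proof.
elim: ss c => //= s ss IH c inv /legal_run_cat[run1 run2] /andP[sr ssr] F.
rewrite inE => /predU1P[->|]; first exact: phase_class_bounds.
exact: IH (reachable_inv_run run1 inv) run2 ssr F.
Qed.

(** Marks are never removed, so the differences telescope. *)
Lemma mem_classes c ss a :
  has (fun F : {set V * V} => a \in F) (classes c ss) =
  (a \in marked (foldl (@step V) c (flatten ss)) :\: marked c).
Proof.
elim: ss c => [|s ss IH] c /=; first by rewrite setDv inE.
rewrite IH /phase_class foldl_cat !in_setD.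
have /subsetP/(_ a) := marked_run c s.
have /subsetP/(_ a) := marked_run (foldl (@step V) c s) (flatten ss).
case: (a \in marked c) => [_ /(_ isT)->//|].
by case: (a \in marked (foldl _ c s)) => [/(_ isT)->|].
Qed.

(** A relation on pairs, so that through [pairwise] both disjointness and the order condition
    survive the removal of empty classes. *)
Definition precedes (F F' : {set V * V}) :=
  [disjoint F & F'] &&
  [forall u, forall v, forall w, ~~ (((v, w) \in F) && ((u, v) \in F'))].

(** An edge of a later class is unmarked when an earlier phase ends, whereas any [(v, w)] marked by
    then has all in-edges of [v] marked. *)
Lemma pairwise_classes r c ss : reachable_inv c ->
  legal_run e r c (flatten ss) -> pairwise precedes (classes c ss).
Proof.
elim: ss c => //= s ss IH c inv /legal_run_cat[run1 run2].
have inv1 := reachable_inv_run run1 inv.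
rewrite (IH _ inv1 run2) andbT; apply/allP => F Fss.
have later a : a \in F -> a \in edges e :\: marked (foldl (@step V) c s).
  move=> aF; have: has (fun F : {set V * V} => a \in F)
      (classes (foldl (@step V) c s) ss) by apply/hasP; exists F.
  rewrite mem_classes !in_setD => /andP[-> am].
  have [/subsetP sub _ _] := reachable_inv_run run2 inv1.
  exact: sub.
apply/andP; split.
  rewrite disjoint_subset; apply/subsetP => a /setDP[am _].
  by apply/negP => /later; rewrite in_setD am.
apply/forallP => u; apply/forallP => v; apply/forallP => w; apply/negP.
case/andP=> /setDP[vw _] /later/setDP[uve /negP]; apply.
have [_ /(_ _ _ vw)/subsetP mI _] := inv1; apply: mI.
by rewrite inE uve /=.
Qed.

(** Segments are cut from the end of the run, so only the first may be incomplete; [.-1] discounts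
    it. *)
Lemma phase_split r (ms : seq (move V)) : 0 < r -> exists ss,
  [/\ flatten ss = ms, all (fun s => cost s <= r) ss &
      r * (size ss).-1 <= cost ms].
Proof.
move=> r_gt0; suff [s [ss [<- sr ssr]]] : exists s ss,
    [/\ s ++ flatten ss = ms, cost s <= r & all (fun s => cost s == r) ss].
  exists (s :: ss); split=> //=.
    by rewrite sr; apply: sub_all ssr => t /eqP->.
  rewrite /cost count_cat; apply: leq_trans (leq_addl _ _).
  elim: ss ssr => [|t ss IH] /=; first by rewrite muln0.
  by case/andP=> /eqP tr ssr; rewrite count_cat mulnS -{1}tr leq_add // IH.
elim: ms => [|m ms [s [ss [<- sr ssr]]]]; first by exists [::], [::].
(* If [s] is full, [m] opens a new first segment, where [0 < r] leaves room for it; otherwise [m]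
   joins [s]. *)
have [full|part] := boolP (cost s == r).
  exists [:: m], (s :: ss); split=> //=; last by rewrite full.
  by rewrite /cost /= addn0; apply: leq_trans (leq_b1 _) r_gt0.
exists (m :: s), ss; split=> //.
by move: sr part; rewrite /cost /=; case: (is_io m); lia.
Qed.

Lemma pebbling_edge_partition r (ms : seq (move V)) :
  0 < r -> pebbling e r ms ->
  exists k, (exists P : k.-tuple {set V * V}, edge_partition e (2 * r) P) /\
    r * k.-1 <= cost ms.
Proof.
move=> r_gt0 [run [_ mfin]]; have [ss [msE ssr ssc]] := phase_split ms r_gt0.
rewrite -msE in run mfin.
(* [partition] forbids an empty class, so phases that mark nothing are dropped; this can only lower
   the number of classes. *)
pose Fs := [seq F <- classes (init e) ss | F != set0].
exists (size Fs); split; last first.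
  apply: leq_trans ssc; rewrite leq_mul2l; apply/orP; right.
  have := size_filter (fun F : {set V * V} => F != set0) (classes (init e) ss).
  have := count_size (fun F : {set V * V} => F != set0) (classes (init e) ss).
  by rewrite size_classes -/Fs => + ->; lia.
have pw : pairwise precedes Fs.
  exact/pairwise_filter/(pairwise_classes reachable_inv_init run).
have pwE i j : i < j < size Fs -> precedes (nth set0 Fs i) (nth set0 Fs j).
  by case/andP=> ij jk; apply: (pairwiseP set0 pw) => //; exact: ltn_trans jk.
have neq0 F : F \in Fs -> F != set0 by rewrite mem_filter => /andP[].
have bounds i : (exists D, edge_dominator e (tnth (in_tuple Fs) i) D /\
    #|D| <= 2 * r) /\ #|edge_terminal (tnth (in_tuple Fs) i)| <= 2 * r.
  apply: (classes_bounds reachable_inv_init run ssr).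
  by have := mem_tnth i (in_tuple Fs); rewrite mem_filter => /andP[].
exists (in_tuple Fs); split; last 2 first.
- by move=> i; case: (bounds i).
- by move=> i; case: (bounds i).
- split.
    (* Two equal entries would be disjoint from each other, hence empty. *)
    rewrite uniq_pairwise; apply: (sub_in_pairwise (P := fun F => F != set0)) pw.
      move=> F F' F0 F'0 /andP[FF' _] /=; apply: contraNneq F0 => FE.
      by rewrite -FE -setI_eq0 setIid in FF'.
    by apply/allP.
  apply/and3P; split.
  - apply/eqP/setP => a; rewrite -mfin; have := mem_classes (init e) ss a.
    rewrite /= setD0 => <-; apply/bigcupP/hasP => -[F].
      by rewrite inE mem_filter => /andP[_ Fss] aF; exists F.
    move=> Fss aF; exists F => //; rewrite inE mem_filter Fss andbT.
    by apply/set0Pn; exists a.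
  - apply/trivIsetP => A B; rewrite !inE => /(nthP set0)[i ik <-] /(nthP set0)[j jk <-].
    case: (ltngtP i j) => [ij|ji|->]; last by rewrite eqxx.
      by have := pwE i j; rewrite ij jk => /(_ isT)/andP[].
    by rewrite disjoint_sym; have := pwE j i; rewrite ji ik => /(_ isT)/andP[].
  - by rewrite inE mem_filter eqxx.
- move=> i j u v w ij; rewrite !(tnth_nth set0) /= => -[vw uv].
  have := pwE i j; rewrite ij ltn_ord => /(_ isT)/andP[_].
  by move=> /forallP/(_ u)/forallP/(_ v)/forallP/(_ w); rewrite vw uv.
Qed.

End Pebbling.

Theorem theorem6p5 (V : finType) (e : rel V) (r : nat) (De : dag e)
    (r_gt0 : 0 < r) :
  (r%:Z%:E * (MIN_edge e (2 * r) - 1%:E) <= OPT_PRBP e r)%E.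
Proof.
rewrite /OPT_PRBP; set Q := (X in emin X).
have [[n [ms peb <-] ->]|->] := eminP Q; last exact: leey.
have [k [part rk]] := pebbling_edge_partition r_gt0 peb.
rewrite /MIN_edge; set P := (X in emin X).
have [k' -> k'k] := @emin_le P k part.
rewrite -EFinB -EFinM lee_fin.
(* If [k'] is 0, the left side is negative; otherwise [k' - 1] is at most [k.-1], and [rk]
   applies. *)
nia.
Qed.
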